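(* Let $d\ge 1$ be an integer and let $\mathcal{P}=(P_{ij})_{i,j=1,\dots,d}$ be a row-stochastic matrix with $P_{ij}>0$ for all $i,j$. Let $\rho=\min_{i,j}P_{ij}>0$. Let $\lambda=(\lambda_1,\dots,\lambda_d)$ be the probability vector satisfying $\lambda\mathcal{P}=\lambda$. Let $\nu=(\nu_1,\dots,\nu_d)$ be any probability vector, and let $(Y_n^\nu)_{n\in\mathbb{N}}$ be the Markov chain on $\{1,\dots,d\}$ with transition matrix $\mathcal{P}$ and initial distribution $\nu$, with law $P_\nu$ on $\{1,\dots,d\}^{\mathbb{N}}$. Then for every $n\in\mathbb{N}$, $$\big|\lambda-P_\nu(Y_n^\nu\in\cdot)\big|_{tv}\le 2\,(1-\rho)^n .$$
   Context: $\mathbb{N}=\{1,2,3,\dots\}$ and the initial time of the chain is $n=1$, i.e. $P_\nu(Y_1^\nu=j)=\nu_j$; the vector $\lambda$ is identified with the corresponding probability on $\{1,\dots,d\}$. For a finite signed measure $\eta$ of total mass $0$ the total variation is $|\eta|_{tv}=2\sup_A\eta(A)$, the supremum being over measurable sets $A$ (here, over all subsets of $\{1,\dots,d\}$). *)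

(* Defs.v *)
From HB Require Import structures.
From mathcomp Require Import all_boot all_order all_algebra.
From mathcomp Require Import all_classical all_reals all_analysis.

Set Implicit Arguments.
Unset Strict Implicit.
Unset Printing Implicit Defensive.

Import Order.TTheory GRing.Theory Num.Theory.
Import numFieldNormedType.Exports.

Local Open Scope classical_set_scope.
Local Open Scope ring_scope.

(* A state space {1, .., d} with d >= 1 is encoded as 'I_n.+1, with d = n.+1
   (measurable types must be inhabited); every subset is measurable. *)
HB.instance Definition _ (n : nat) := isPointed.Build 'I_n.+1 ord0.

HB.instance Definition _ (n : nat) := @isMeasurable.Build
  default_measure_display 'I_n.+1 discrete_measurable discrete_measurable0
  discrete_measurableC discrete_measurableU.

Definition prob_vector {R : realType} {n : nat} (p : 'rV[R]_n) : Prop :=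
  (forall j, 0 <= p ord0 j) /\ \sum_j p ord0 j = 1.

Definition row_stochastic {R : realType} {n : nat} (P : 'M[R]_n) : Prop :=
  forall i, prob_vector (row i P).

Definition min_entry {R : realType} {n : nat} (P : 'M[R]_n.+1) : R :=
  \big[Num.min/P ord0 ord0]_(ij : 'I_n.+1 * 'I_n.+1) P ij.1 ij.2.

(* The signed measure \sum_i p_i \d_i with which the vector p is identified. *)
Definition vector_charge {R : realType} {n : nat} (p : 'rV[R]_n.+1)
    (A : set 'I_n.+1) : \bar R :=
  (\sum_(i < n.+1) (p ord0 i)%:E * \d_i A)%E.

Section vector_charge_is_charge.
Local Open Scope ereal_scope.
Context {R : realType} {n : nat}.
Variable p : 'rV[R]_n.+1.

Let vector_chargeP :
  exists c : {charge set 'I_n.+1 -> \bar R}, vector_charge p = c.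
Proof.
suff H (s : seq 'I_n.+1) : exists c : {charge set 'I_n.+1 -> \bar R},
    (fun A => \sum_(i <- s) (p ord0 i)%:E * \d_i A) = c by exact: H.
elim: s => [|i s [c cE]].
  by exists czero; apply/funext => A; rewrite big_nil.
exists (cadd (cscale (p ord0 i) (charge_of_finite_measure \d_i)) c).
by apply/funext => A; rewrite big_cons /= /cadd /= -cE.
Qed.

Let vector_charge0 : vector_charge p set0 = 0.
Proof. by have [c ->] := vector_chargeP; exact: charge0. Qed.

Let vector_charge_finite A : measurable A -> vector_charge p A \is a fin_num.
Proof. by have [c ->] := vector_chargeP; exact: fin_num_measure. Qed.

Let vector_charge_sigma_additive : semi_sigma_additive (vector_charge p).
Proof.
by have [c ->] := vector_chargeP; exact: charge_semi_sigma_additive.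
Qed.

HB.instance Definition _ := isCharge.Build _ _ _ (vector_charge p)
  vector_charge0 vector_charge_finite vector_charge_sigma_additive.

End vector_charge_is_charge.

Definition csub {d} {T : measurableType d} {R : realType}
    (mu nu : {charge set T -> \bar R}) : {charge set T -> \bar R} :=
  cadd mu (copp nu).

(* Used for signed measures of total mass 0, for which it coincides with the
   mass of T under the variation |eta|. *)
Definition tv_norm {d} {T : measurableType d} {R : realType}
    (eta : {charge set T -> \bar R}) : \bar R :=
  (2%:E * ereal_sup [set eta A | A in measurable])%E.

Definition cond_prob {d} {T : measurableType d} {R : realType}
    (Pr : probability T R) (A B : set T) : R :=
  fine (Pr (A `&` B)) / fine (Pr B).

(* Time starts at 1; the value Y 0 is unconstrained and plays no role. *)
Definition markov_chain {d} {T : measurableType d} {R : realType} {n : nat}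
    (Pr : probability T R) (nu : 'rV[R]_n.+1) (P : 'M[R]_n.+1)
    (Y : nat -> {RV Pr >-> 'I_n.+1}) : Prop :=
  (forall j, Pr (Y 1%N @^-1` [set j]) = (nu ord0 j)%:E) /\
  (forall (m : nat) (s : nat -> 'I_n.+1), (1 <= m)%N ->
     let history := [set w | forall k, (1 <= k <= m)%N -> Y k w = s k] in
     (0 < Pr history)%E ->
     cond_prob Pr (Y m.+1 @^-1` [set s m.+1]) history = P (s m) (s m.+1)).

(* Main.v *)
(* Averaging a function f against a row of P keeps it above min f and below
   b - rho (b - min f), where b bounds f from above: P shrinks the range of f by
   the factor 1 - rho. Applied m - 1 times to the indicator of A this bounds
   lambda(A) - P_nu(Y_m in A) = lambda(f) - nu(f) with f = P^(m-1) 1_A, and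
   lambda = lambda P provides the m-th factor. *)
Require Import Defs.
From HB Require Import structures.
From mathcomp Require Import all_boot all_order all_algebra.
From mathcomp Require Import all_classical all_reals all_analysis.
From mathcomp Require Import lra.

Set Implicit Arguments.
Unset Strict Implicit.
Unset Printing Implicit Defensive.

Import Order.TTheory GRing.Theory Num.Theory.
Import numFieldNormedType.Exports.

Local Open Scope classical_set_scope.
Local Open Scope ring_scope.

Section DoeblinContraction.
Variables (R : realType) (n : nat) (P : 'M[R]_n.+1).
Hypothesis P_stochastic : row_stochastic P.

Lemma min_entry_le i j : min_entry P <= P i j.
Proof. exact: (bigmin_le _ (i, j)). Qed.

Lemma row_stochastic_sum i : \sum_j P i j = 1.
Proof. by rewrite -(P_stochastic i).2; apply: eq_bigr => j _; rewrite mxE. Qed.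

Lemma min_entry_le1 : min_entry P <= 1.
Proof.
rewrite (le_trans (min_entry_le ord0 ord0))// -(row_stochastic_sum ord0).
rewrite (bigD1 ord0)//= lerDl sumr_ge0// => j _.
by have := (P_stochastic ord0).1 j; rewrite mxE.
Qed.

Lemma prob_vector_mulmx_ge (p : 'rV[R]_n.+1) (f : 'cV[R]_n.+1) a :
  prob_vector p -> (forall i, a <= f i ord0) -> a <= (p *m f) ord0 ord0.
Proof.
move=> [p0 p1] af; rewrite mxE -[leLHS]mul1r -p1 mulr_suml.
by apply: ler_sum => j _; exact: ler_wpM2l.
Qed.

Lemma prob_vector_mulmx_le (p : 'rV[R]_n.+1) (f : 'cV[R]_n.+1) b :
  prob_vector p -> (forall i, f i ord0 <= b) -> (p *m f) ord0 ord0 <= b.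
Proof.
move=> [p0 p1] fb; rewrite mxE -[leRHS]mul1r -p1 mulr_suml.
by apply: ler_sum => j _; exact: ler_wpM2l.
Qed.

Lemma stochastic_mulmx_ge (f : 'cV[R]_n.+1) a :
  (forall i, a <= f i ord0) -> forall i, a <= (P *m f) i ord0.
Proof.
move=> af i; have := prob_vector_mulmx_ge (P_stochastic i) af.
by rewrite -row_mul mxE.
Qed.

(* Row i puts mass at least [min_entry P] on the state [k], so the average of f
   along that row falls short of [b] by at least the corresponding amount. *)
Lemma stochastic_mulmx_le (f : 'cV[R]_n.+1) b k :
  (forall i, f i ord0 <= b) ->
  forall i, (P *m f) i ord0 <= b - min_entry P * (b - f k ord0).
Proof.
move=> fb i.
rewrite lerBrDl -lerBrDr.
have -> : b - (P *m f) i ord0 = \sum_j P i j * (b - f j ord0).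
  rewrite mxE -{1}[b]mul1r -(row_stochastic_sum i) mulr_suml -sumrB.
  by apply: eq_bigr => j _; rewrite mulrBr.
have h j : 0 <= P i j * (b - f j ord0).
  by have := (P_stochastic i).1 j; rewrite mxE => ?; rewrite mulr_ge0// subr_ge0.
rewrite (bigD1 k)//= (@le_trans _ _ (P i k * (b - f k ord0)))//.
  by rewrite ler_wpM2r ?min_entry_le// subr_ge0.
by rewrite lerDl sumr_ge0.
Qed.

(** Induction on [k], passing from [f] to [P *m f]: this keeps the average under [lambda] and
    shrinks the range, so [f], [a], [b] must vary. The exponent is [k.+1] because by stationarity
    [lambda] averages [P *m f] already at [k = 0]. *)
Lemma stationary_contraction (lambda nu : 'rV[R]_n.+1) k (f : 'cV[R]_n.+1) a b :
  prob_vector lambda -> lambda *m P = lambda -> prob_vector nu ->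
  (forall i, a <= f i ord0 <= b) ->
  (lambda *m f) ord0 ord0 - (nu *m (P ^+ k *m f)) ord0 ord0 <=
    (1 - min_entry P) ^+ k.+1 * (b - a).
Proof.
move=> lambda_prob lambdaP nu_prob.
elim: k f a b => [|k IH] f a b fab;
  (* With the minimum f(j) as lower bound in place of [a], the new range has length (1 - rho)(b -
     f(j)), which is at most (1 - rho)(b - a). *)
  have [j _ f_min] := @arg_minP _ _ _ ord0 xpredT (fun i => f i ord0) isT;
  have /andP[afj _] := fab j;
  have fb i : f i ord0 <= b := proj2 (andP (fab i));
  have fge i : f j ord0 <= f i ord0 := f_min i isT;
  have Pf_le := stochastic_mulmx_le j fb.
- rewrite expr0 mul1mx -{1}lambdaP -mulmxA expr1.
  have := prob_vector_mulmx_le lambda_prob Pf_le.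
  have := prob_vector_mulmx_ge nu_prob fge.
  have := min_entry_le1; nra.
- have Pf_ge := stochastic_mulmx_ge fge.
  have Pf_bd i : f j ord0 <= (P *m f) i ord0
      <= b - min_entry P * (b - f j ord0) by rewrite Pf_ge Pf_le.
  have := IH _ _ _ Pf_bd.
  rewrite (exprSr P k) -mulmxE !mulmxA lambdaP => /le_trans; apply.
  rewrite [leRHS](_ : _ = (1 - min_entry P) ^+ k.+1 *
    ((1 - min_entry P) * (b - a))); last by rewrite mulrA -exprSr.
  rewrite ler_wpM2l ?exprn_ge0 ?subr_ge0 ?min_entry_le1//.
  have := min_entry_le1; nra.
Qed.

End DoeblinContraction.

Section MarkovChainLaw.
Variables (R : realType) (n : nat) (disp : measure_display).
Variables (Omega : measurableType disp) (Pr : probability Omega R).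

(** Holds for every [A] since the state space carries the discrete sigma-algebra. *)
Lemma measurable_RV_preimage (X : {RV Pr >-> 'I_n.+1}) (A : set 'I_n.+1) :
  measurable (X @^-1` A).
Proof. exact: measurable_funPTI. Qed.

(** Law of total probability over the finitely many disjoint events X = x, stated in the reals so
    that it can be matched with matrix products. *)
Lemma fine_probability_partition (X : {RV Pr >-> 'I_n.+1}) (A : set Omega) :
  measurable A ->
  fine (Pr A) = \sum_x fine (Pr (A `&` X @^-1` [set x])).
Proof.
move=> mA; have mI x : measurable (A `&` X @^-1` [set x]).
  by apply: measurableI => //; exact: measurable_RV_preimage.
rewrite sum_fine; last by move=> x _; exact: fin_num_measure.
rewrite -measure_bigsetU_ord//; last first.
  by move=> x y _ _ [w [[_ <-] [_ <-]]].
rewrite -bigcup_seq; congr (fine (Pr _)); apply/seteqP; split => w /=.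
- by move=> Aw; exists (X w) => //=; rewrite mem_index_enum.
- by case=> x _ [].
Qed.

Variables (nu : 'rV[R]_n.+1) (P : 'M[R]_n.+1) (Y : nat -> {RV Pr >-> 'I_n.+1}).
Hypothesis Y_markov : markov_chain nu P Y.

(** The lower end [k] interpolates between the full history of the Markov property ([k = 1]) and the
    single event Y_m = s(m) ([k = m]). *)
Let path_event k m (s : nat -> 'I_n.+1) : set Omega :=
  [set w | forall i, (k <= i <= m)%N -> Y i w = s i].

Let measurable_path_event k m s : measurable (path_event k m s).
Proof.
rewrite (_ : path_event k m s =
    \bigcap_(i in [set i | (k <= i <= m)%N]) (Y i @^-1` [set s i])).
  by apply: bigcap_measurableType => i _; exact: measurable_RV_preimage.
by apply/seteqP; split.
Qed.

(* Summing over the value of Y k turns the history from time k on into the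
   history from time k+1 on. *)
Let markov_path k m s : (1 <= k <= m)%N ->
  fine (Pr (path_event k m s `&` Y m.+1 @^-1` [set s m.+1])) =
  fine (Pr (path_event k m s)) * P (s m) (s m.+1).
Proof.
elim: k s => // k IH s; case: (posnP k) => [-> /= m1|k_gt0 /= km].
  have := Y_markov.2 m s m1; rewrite -/(path_event 1 m s) /cond_prob setIC.
  (* The Markov property speaks only of histories of positive probability; for a null history both
     sides of the product form vanish. *)
  have [Pr0 _|Pr_gt0 /(_ isT)] := leP (Pr (path_event 1 m s)) 0%E.
    have -> : Pr (path_event 1 m s) = 0%E by apply/le_anti; rewrite Pr0/=.
    rewrite mul0r (_ : Pr _ = 0%E)//; apply/le_anti; rewrite measure_ge0 andbT.
    rewrite (le_trans _ Pr0)// le_measure ?inE//.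
    by apply: measurableI => //; exact: measurable_RV_preimage.
  move=> <-; rewrite mulrC divfK//; apply/eqP => Pr0; move: Pr_gt0.
  by rewrite -[Pr _]fineK ?fin_num_measure// Pr0 ltxx.
(* The path [s' x] is [s] with value x at time k. Since k < m, the states at times m and m+1 are
   unchanged, so the transition factor is the same for all x and comes out of the sum. *)
pose s' x i := if i == k then x else s i.
have pathE x : path_event k.+1 m s `&` Y k @^-1` [set x] = path_event k m (s' x).
  apply/seteqP; split=> w /=.
    move=> [sw Ykw] i /andP[ki im]; rewrite /s'.
    case: eqVneq => [->//|ik]; apply: sw.
    by rewrite im andbT ltn_neqAle eq_sym ik.
  move=> sw; split; last by rewrite (sw k) /s' ?eqxx// leqnn ltnW.
  move=> i /andP[ki im]; rewrite sw /s'; last by rewrite im andbT ltnW.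
  by rewrite gtn_eqF.
have s'E x i : (k < i)%N -> s' x i = s i by move=> ki; rewrite /s' gtn_eqF.
rewrite (fine_probability_partition (Y k) (measurable_path_event k.+1 m s)).
rewrite (fine_probability_partition (Y k)); last first.
  by apply: measurableI => //; exact: measurable_RV_preimage.
rewrite mulr_suml; apply: eq_bigr => x _.
rewrite setIAC pathE -[in LHS](s'E x m.+1); last by rewrite ltnS ltnW.
rewrite IH; last by rewrite k_gt0 ltnW.
by rewrite !s'E// ltnS ltnW.
Qed.

(** The power lags the time by one because [nu] is the law at time 1. Each step conditions on the
    state at the preceding time. *)
Lemma markov_chain_law m j :
  fine (Pr (Y m.+1 @^-1` [set j])) = (nu *m P ^+ m) ord0 j.
Proof.
elim: m j => [|m IH] j; first by rewrite expr0 mulmx1 Y_markov.1.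
rewrite (fine_probability_partition (Y m.+1)); last first.
  exact: measurable_RV_preimage.
rewrite exprSr mulmxA mxE; apply: eq_bigr => i _; rewrite -IH.
(* A path through i at time m+1 and j at time m+2; its values at other times do not enter the
   one-point history from m+1 to m+1. *)
pose s k := if k == m.+1 then i else j.
have := @markov_path m.+1 m.+1 s; rewrite /s eqxx gtn_eqF// => /(_ _)/=.
have -> : path_event m.+1 m.+1 (fun k => if k == m.+1 then i else j) =
    Y m.+1 @^-1` [set i].
  apply/seteqP; split=> w /=.
    by move=> /(_ m.+1); rewrite eqxx leqnn; exact.
  by move=> Yw k; rewrite -eqn_leq => /eqP <-; rewrite eqxx.
by rewrite setIC; apply; rewrite leqnn.
Qed.

Lemma fine_distribution_sum m (A : set 'I_n.+1) :
  fine (distribution Pr (Y m.+1) A) =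
  \sum_j (nu *m P ^+ m) ord0 j * (j \in A)%:R.
Proof.
rewrite /distribution /pushforward.
rewrite (fine_probability_partition (Y m.+1)); last first.
  exact: measurable_RV_preimage.
apply: eq_bigr => j _; rewrite -markov_chain_law.
case: (boolP (j \in A)) => [/set_mem Aj|/negP jA].
  rewrite mulr1; congr (fine (Pr _)); apply/seteqP.
  by split=> [w []//|w /= Yw]; split=> //; rewrite /= Yw.
rewrite mulr0 (_ : _ `&` _ = set0) ?measure0//.
by apply/seteqP; split=> // w /= [AY Yw]; apply: jA; rewrite inE -Yw.
Qed.

End MarkovChainLaw.

Theorem theorem1 (R : realType) (n : nat) (P : 'M[R]_n.+1)
    (P_stochastic : row_stochastic P) (P_gt0 : forall i j, 0 < P i j)
    (lambda : 'rV[R]_n.+1) (lambda_prob : prob_vector lambda)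
    (lambda_stationary : lambda *m P = lambda)
    (nu : 'rV[R]_n.+1) (nu_prob : prob_vector nu)
    (disp : measure_display) (Omega : measurableType disp)
    (Pr : probability Omega R) (Y : nat -> {RV Pr >-> 'I_n.+1})
    (Y_markov : markov_chain nu P Y)
    (m : nat) (m_ge1 : (1 <= m)%N) :
  (tv_norm (csub (vector_charge lambda)
                 (charge_of_finite_measure (distribution Pr (Y m))))
     <= (2 * (1 - min_entry P) ^+ m)%:E)%E.
Proof.
(* From here the time is [m.+1], so the law is nu P^m while the bound has exponent m+1. *)
case: m m_ge1 => // m _.
(* The factor 2 cancels, and the supremum is bounded by treating each set [A] separately. *)
rewrite /tv_norm EFinM lee_pmul2l//; apply: ge_ereal_sup => _ [A mA <-].
set c := charge_of_finite_measure _.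
have cA : c A = (\sum_j (nu *m P ^+ m) ord0 j * (j \in A)%:R)%:E.
  rewrite -(fine_distribution_sum Y_markov) fineK//.
  exact: fin_num_measure.
have lA : vector_charge lambda A = (\sum_j lambda ord0 j * (j \in A)%:R)%:E.
  rewrite /vector_charge -sumEFin; apply: eq_bigr => j _.
  by rewrite diracE -EFinM.
have -> : csub (vector_charge lambda) c A = (vector_charge lambda A - c A)%E by [].
rewrite cA lA -EFinD lee_fin.
(* The indicator of [A] as a column turns both masses of [A] into matrix products; its range lies in
   [0, 1], so b - a = 1. *)
pose f : 'cV[R]_n.+1 := \col_j (j \in A)%:R.
have mul_indicator (p : 'rV[R]_n.+1) :
    \sum_j p ord0 j * (j \in A)%:R = (p *m f) ord0 ord0.
  by rewrite mxE; apply: eq_bigr => j _; rewrite mxE.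
have f01 i : 0 <= f i ord0 <= 1 by rewrite mxE; case: (i \in A); rewrite ?lexx ler01.
rewrite !mul_indicator -mulmxA.
by have := stationary_contraction P_stochastic m lambda_prob lambda_stationary
  nu_prob f01; rewrite subr0 mulr1.
Qed.
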